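(* Let $n\in\mathbb{N}$ not be a prime power, and suppose $\kappa(\mathcal{G}(\mathbb{Z}_n))=\delta(\mathcal{G}(\mathbb{Z}_n))=k$. Then $n$ is even and $k=\deg\big(\overline{n/2}\big)=n-\frac{n}{2^{\alpha}}$, where $\alpha$ is the largest integer such that $2^{\alpha}\mid n$.
   Context: $\mathbb{Z}_n$ is the additive group of integers modulo $n$. The power graph $\mathcal{G}(G)$ has vertex set $G$, distinct $u,v$ adjacent iff one is a positive integer power (multiple) of the other. $\delta$ is minimum degree and $\kappa$ is vertex connectivity (minimum number of vertices whose removal yields a disconnected or trivial graph). *)

(* Defs.v *)
From mathcomp Require Import all_boot all_order all_fingroup all_solvable all_algebra.
Set Implicit Arguments.
Unset Strict Implicit.
Unset Printing Implicit Defensive.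

(* k = 0 is allowed, so 1 is a prime power. *)
Definition prime_power (n : nat) : Prop :=
  exists p k : nat, prime p /\ n = p ^ k.

Section Graph.
Variables (T : finType) (e : rel T).

Definition degree (x : T) : nat := #|[set y | e x y]|.

(* The default value #|T| is larger than every degree of a simple graph, so it
   plays no role as soon as T is inhabited. *)
Definition min_degree : nat := \big[minn/#|T|]_(x : T) degree x.

Definition delete_vertices (S : {set T}) : rel T :=
  [rel x y | [&& x \notin S, y \notin S & e x y]].

Definition disconnects (S : {set T}) : bool :=
  [exists x in ~: S, exists y in ~: S, ~~ connect (delete_vertices S) x y].

Definition leaves_trivial (S : {set T}) : bool := #|~: S| == 1.

(* For inhabited T, deleting all vertices but one leaves the trivial graph, so
   the default value #|T| is never reached. *)
Definition vertex_connectivity : nat :=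
  \big[minn/#|T|]_(S : {set T} | disconnects S || leaves_trivial S) #|S|.

End Graph.

Section PowerGraph.
Variable gT : finGroupType.
Implicit Types x y : gT.

(* The exponents 1, ..., #|gT| give all positive powers, see is_powerP. On
   'Z_n the group law is addition, so x ^+ m is the multiple x *+ m. *)
Definition is_power y x : bool :=
  [exists m : 'I_#|gT|, y == (x ^+ m.+1)%g].

Lemma is_powerP y x :
  reflect (exists2 m, 0 < m & y = (x ^+ m)%g) (is_power y x).
Proof.
apply: (iffP existsP) => [[m /eqP ->]|[m m_gt0 ->]]; first by exists m.+1.
have gT_gt0 : 0 < #|gT| by rewrite -cardsT cardG_gt0.
exists (Ordinal (ltn_pmod m.-1 gT_gt0)) => /=; apply/eqP.
have x1 : (x ^+ #|gT| = 1)%g by rewrite -cardsT expg_cardG ?inE.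
by rewrite expgS (expg_mod _ x1) -expgS prednK.
Qed.

Definition power_graph : rel gT :=
  [rel x y | (x != y) && (is_power y x || is_power x y)].

End PowerGraph.

Arguments power_graph gT : clear implicits.

(* Main.v *)
(** Let x be a vertex of minimum degree. Since x and its inverse generate the
    same subgroup, they have the same closed neighbourhood; so if they differ,
    deleting all the neighbours of x except x^-1 isolates {x, x^-1}, and the
    connectivity is smaller than the minimum degree. Hence equality forces
    x^2 = 1. The identity is adjacent to every vertex, and cannot have minimum
    degree because the graph is not complete: x is the involution of Z_n. A
    vertex y <> x is adjacent to x iff y = 0 or y has even order, and the
    elements of odd order form the Hall 2'-subgroup, of order n / 2^alpha. *)

Require Import Defs.
From mathcomp Require Import all_boot all_order all_fingroup all_solvable all_algebra.

Set Implicit Arguments.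
Unset Strict Implicit.
Unset Printing Implicit Defensive.

Lemma bigminn_leq (I : finType) (P : pred I) (F : I -> nat) (d : nat) (i : I) :
  P i -> \big[minn/d]_(j | P j) F j <= F i.
Proof.
move=> Pi; have: i \in index_enum I by rewrite mem_index_enum.
elim: (index_enum I) => // j s IHs; rewrite inE big_cons.
case/predU1P=> [<-|/IHs le_i]; first by rewrite Pi geq_minl.
by case: (P j) => //; apply: leq_trans le_i; apply: geq_minr.
Qed.

Section Graph.
Variables (T : finType) (e : rel T).

Lemma min_degree_leq (x : T) : min_degree e <= degree e x.
Proof. exact: bigminn_leq. Qed.

Lemma vertex_connectivity_leq (S : {set T}) :
  disconnects e S -> vertex_connectivity e <= #|S|.
Proof. by move=> dS; apply: bigminn_leq; rewrite dS. Qed.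

(** Neither [x] nor [y] is a neighbour of [x], so two vertices are missed. *)
Lemma degree_leq_pred (x y : T) :
  irreflexive e -> x != y -> ~~ e x y -> degree e x < #|T|.-1.
Proof.
move=> e_irr neq_xy nexy.
have : degree e x + #|[set x; y]| <= #|T|.
  rewrite -cardsT -(cardsID [set y | e x y] setT) setTI leq_add2l.
  apply/subset_leq_card/subsetP=> z.
  by rewrite !inE => /orP[] /eqP->; rewrite ?e_irr ?nexy.
by rewrite cards2 neq_xy addn2 => /leP/le_pred/leP.
Qed.

Lemma degree_dominating (x : T) :
  (forall y, y != x -> e x y) -> #|T|.-1 <= degree e x.
Proof.
move=> adj; rewrite -cardsT (cardsD1 x setT) inE add1n /=.
by apply/subset_leq_card/subsetP=> y; rewrite !inE andbT; apply: adj.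
Qed.

Lemma min_degree_attained (x0 : T) :
  irreflexive e -> exists x, min_degree e = degree e x.
Proof.
move=> e_irr; have: min_degree e < #|T|.
  apply: leq_ltn_trans (min_degree_leq x0) _.
  rewrite -cardsT; apply/proper_card/properP; split; first exact: subsetT.
  by exists x0; rewrite ?inE ?e_irr.
(* The iterated minimum is its default value or a degree; the strict bound just proved excludes the
   default. *)
have: min_degree e = #|T| \/ exists x, min_degree e = degree e x.
  rewrite /min_degree; elim/big_ind: _ => [|m1 m2 H1 H2|x _]; first by left.
    by rewrite /minn; case: ifP.
  by right; exists x.
by case=> // ->; rewrite ltnn.
Qed.

Lemma vertex_connectivity_twins (x x' y : T) :
    irreflexive e -> e x x' -> (forall z, e x' z -> z != x -> e x z) ->
    y != x -> ~~ e x y ->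
  vertex_connectivity e < degree e x.
Proof.
move=> e_irr exx' twins neq_yx nexy.
pose S := [set z | e x z] :\ x'.
suff dS : disconnects e S.
  rewrite /degree (cardsD1 x') inE exx' add1n ltnS.
  exact: vertex_connectivity_leq.
have xS : x \in ~: S by rewrite !inE e_irr andbF.
have yS : y \in ~: S by rewrite !inE (negPf nexy) andbF.
apply/existsP; exists x; rewrite xS; apply/existsP; exists y; rewrite yS /=.
(* No surviving edge leaves [{x, x'}]: a vertex outside [S] other than [x'] is not adjacent to [x],
   hence, unless it is [x], not to [x'] either. *)
have step u v : delete_vertices e S u v -> u \in pred2 x x' -> v \in pred2 x x'.
  rewrite !inE /= => /and3P[_]; rewrite !inE negb_and negbK.
  have [//|neq_vx'] := eqVneq v x'; first by rewrite orbT.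
  rewrite /= orbF => nexv euv /orP[] /eqP Du; rewrite {u}Du in euv.
    by rewrite euv in nexv.
  by apply: contraNT nexv; apply: twins.
have walk p u : path (delete_vertices e S) u p -> u \in pred2 x x' ->
    last u p \in pred2 x x'.
  elim: p u => //= v p IHp u /andP[euv pth] xu.
  exact: IHp pth (step _ _ euv xu).
apply/connectP=> -[p /walk]; rewrite inE eqxx => /(_ isT) + Dy.
rewrite -Dy inE (negPf neq_yx) => /eqP Dyx'.
by rewrite Dyx' exx' in nexy.
Qed.
End Graph.

Section PowerGraph.
Variable gT : finGroupType.
Implicit Types x y z : gT.
Local Open Scope group_scope.

Lemma is_power_cycle y x : is_power y x = (y \in <[x]>).
Proof.
apply/is_powerP/idP=> [[m _ ->]|/cycleP[m ->]]; first exact: mem_cycle.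
(* Adding the order makes the exponent positive even when [m = 0]. *)
exists (m + #[x])%N; first by rewrite addn_gt0 order_gt0 orbT.
by rewrite expgD expg_order mulg1.
Qed.

Lemma power_graphE x y :
  power_graph gT x y = (x != y) && ((y \in <[x]>) || (x \in <[y]>)).
Proof. by rewrite -!is_power_cycle. Qed.

Lemma power_graph_irr : irreflexive (power_graph gT).
Proof. by move=> x; rewrite power_graphE eqxx. Qed.

(** Cauchy's theorem gives elements of distinct prime orders; neither order divides the other, so
    neither element lies in the subgroup generated by the other. *)
Lemma power_graph_nonadjacent :
    ~ prime_power #|gT| ->
  exists x y, (x != y) && ~~ power_graph gT x y.
Proof.
move=> npp; pose p := pdiv #|gT|.
have gT_gt1 : (1 < #|gT|)%N.
  rewrite ltn_neqAle -{2}cardsT cardG_gt0 andbT eq_sym.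
  by apply/eqP=> gT1; apply: npp; exists 2, 0%N.
have p_pr : prime p by apply: pdiv_prime.
have [q [q_pr q_dvd neq_qp]] : exists q, [/\ prime q, q %| #|gT| & q != p]%N.
  (* If [p] were the only prime divisor, the group order would equal its own [p]-part. *)
  have /allPn[q] : ~~ all (pred1 p) (primes #|gT|).
    apply/negP=> /allP pP; apply: npp; exists p, (logn p #|gT|); split=> //.
    rewrite -p_part part_pnat_id // /pnat (ltnW gT_gt1).
    by apply/allP.
  by rewrite mem_primes => /and3P[q_pr _ q_dvd] /= neq_qp; exists q.
have [x _ ox] := Cauchy p_pr (etrans (congr1 _ (cardsT gT)) (pdiv_dvd _)).
have [y _ oy] := Cauchy q_pr (etrans (congr1 _ (cardsT gT)) q_dvd).
exists x, y; rewrite power_graphE.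
have ndvd (a b : gT) : prime #[a] -> prime #[b] -> #[a] != #[b] -> a \notin <[b]>.
  by move=> pa pb; apply: contra => /order_dvdG; rewrite dvdn_prime2.
rewrite negb_and negb_or !ndvd ?ox ?oy ?orbT ?andbT // 1?eq_sym //.
by apply: contraNneq neq_qp => Dx; rewrite -ox -oy Dx.
Qed.

Lemma min_degree_involution :
    ~ prime_power #|gT| ->
    vertex_connectivity (power_graph gT) = min_degree (power_graph gT) ->
  exists2 x, #[x] = 2 & min_degree (power_graph gT) = degree (power_graph gT) x.
Proof.
move=> npp Dk; have irr := power_graph_irr.
have [u [v /andP[neq_uv nadj_uv]]] := power_graph_nonadjacent npp.
have [x Dx] := min_degree_attained (1 : gT) irr; exists x => //.
have ndom : ~ forall y, y != x -> power_graph gT x y.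
  move/degree_dominating; rewrite -Dx leqNgt => /negP[].
  exact: leq_ltn_trans (min_degree_leq _ u) (degree_leq_pred irr neq_uv nadj_uv).
have [y /andP[neq_yx nadj]] : exists y, (y != x) && ~~ power_graph gT x y.
  apply/existsP; apply: contra_notT ndom => /existsPn adj y neq_yx.
  by have := adj y; rewrite neq_yx negbK.
apply: nt_prime_order => //; last first.
  apply: contraNneq nadj => x1.
  by rewrite power_graphE eq_sym neq_yx x1 group1 orbT.
(* The goal [x ^+ 2 = 1] now reads [x^-1 = x]; otherwise [x^-1] is a twin of [x]. *)
apply/eqP; rewrite expgS expg1 -eq_invg_mul; apply: contraTT isT => neq_V.
have : (vertex_connectivity (power_graph gT) < degree (power_graph gT) x)%N.
  apply: (@vertex_connectivity_twins _ _ x x^-1 y) => //.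
    by rewrite power_graphE eq_sym neq_V groupV cycle_id.
  move=> z; rewrite !power_graphE cycleV groupV eq_sym => /andP[_ adj] neq_zx.
  by rewrite eq_sym neq_zx.
by rewrite Dk Dx ltnn.
Qed.

Lemma card_even_order :
    abelian [set: gT] ->
  #|[set y : gT | 2 %| #[y]]| = (#|gT| - #|gT| %/ 2 ^ logn 2 #|gT|)%N.
Proof.
move=> abG; set G := [set: gT].
have hallK : 2^'.-Hall(G) 'O_2^'(G) := nilpotent_pcore_Hall _ (abelian_nil abG).
have -> : [set y : gT | 2 %| #[y]] = G :\: 'O_2^'(G).
  apply/setP=> y; rewrite !inE andbT (mem_normal_Hall hallK) ?pcore_normal ?inE //.
  by rewrite /p_elt p'natE // negbK.
rewrite cardsD (setIidPr (pcore_sub _ _)) (card_Hall hallK) cardsT; congr (_ - _)%N.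
have G_gt0 : (0 < #|gT|)%N by rewrite -cardsT cardG_gt0.
(* Dividing the group order by its 2-part leaves its 2'-part, the order of the Hall subgroup. *)
by rewrite -{2}(partnC 2 G_gt0) p_part mulKn ?expn_gt0.
Qed.

Lemma degree_involution x :
    cyclic [set: gT] -> #[x] = 2 ->
  degree (power_graph gT) x = (#|gT| - #|gT| %/ 2 ^ logn 2 #|gT|)%N.
Proof.
move=> cycG ox; rewrite -(card_even_order (cyclic_abelian cycG)).
have x_neq1 : x != 1 by rewrite -order_eq1 ox.
(* For even [#[y]], Cauchy gives an involution in [<[y]>]; it generates [<[x]>], since a cyclic
   group has at most one subgroup of each order. *)
have in_cycle y : (x \in <[y]>) = (2 %| #[y]).
  apply/idP/idP => [/order_dvdG|/Cauchy[]// z zy oz]; first by rewrite ox.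
  have : <[x]> = <[z]>.
    by apply/eqP; rewrite (eq_subG_cyclic cycG) ?subsetT // -!orderE ox oz.
  by move=> Dx; rewrite -cycle_subG Dx cycle_subG.
rewrite /degree.
(* Exchanging [x] for the identity keeps the cardinality. *)
have -> : [set y | power_graph gT x y] = 1 |: ([set y | 2 %| #[y]] :\ x).
  apply/setP=> y; rewrite inE power_graphE in_cycle !inE (cycle2g ox) !inE.
  have [->|neq_y1] := eqVneq y 1; first by rewrite x_neq1.
  by rewrite eq_sym; case: eqVneq.
have x_even : x \in [set y : gT | 2 %| #[y]] by rewrite inE ox.
by rewrite cardsU1 !inE order1 andbF [RHS](cardsD1 x) x_even.
Qed.
End PowerGraph.

Theorem theorem6p4 (n k : nat) (n_gt0 : 0 < n) (n_npp : ~ prime_power n)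
    (hkappa : vertex_connectivity (power_graph 'Z_n) = k)
    (hdelta : min_degree (power_graph 'Z_n) = k) :
  [/\ ~~ odd n,
      k = degree (power_graph 'Z_n) (inZp n./2)
    & k = n - n %/ 2 ^ logn 2 n].
Proof.
(* Needed for ['Z_n] to have exactly [n] elements: ['Z_1] has two. *)
have n_gt1 : 1 < n.
  rewrite ltn_neqAle n_gt0 andbT eq_sym.
  by apply/eqP=> n1; apply: n_npp; exists 2, 0.
have oZ : #|'Z_n| = n by rewrite card_ord Zp_cast.
have cycZ : cyclic [set: 'Z_n] by apply/cyclicP; exists Zp1; apply: Zp_cycle.
have [x ox Dx] : exists2 x : 'Z_n, #[x]%g = 2
    & min_degree (power_graph 'Z_n) = degree (power_graph 'Z_n) x.
  by apply: min_degree_involution; rewrite ?oZ ?hkappa.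
have n_even : ~~ odd n.
  by rewrite -dvdn2 -[X in _ %| X]oZ -ox -cardsT order_dvdG ?inE.
(* Twice [n./2] is [n] by evenness, and [0 < n./2 < n]. *)
have oh : #[inZp n./2 : 'Z_n]%g = 2.
  apply: nt_prime_order => //.
    apply/val_inj; rewrite Zp_expg /= modnMml Zp_cast // muln2 even_halfK //.
    by rewrite modnn.
  apply/eqP=> /(congr1 val) /=; rewrite Zp_cast // modn_small.
    by apply/eqP; rewrite -lt0n half_gt0.
  by rewrite -divn2 ltn_Pdiv.
(* All elements of order 2 get the same degree formula, so [x] need not be identified with
   [inZp n./2]. *)
by split=> //; rewrite -hdelta Dx !degree_involution // oZ.
Qed.
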